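(* Let $d, n, N$ be positive integers with $n \le N$, let $N_1,\ldots,N_{d+1}$ be nonnegative integers with $N_1+\dots+N_{d+1}=N$, put $\boldsymbol{N}=(N_1,\ldots,N_d)$ and $p_i = N_i/N$ for $i\in\{1,\ldots,d\}$, and let $\boldsymbol{X}=(X_1,\ldots,X_d)\sim \mathrm{Hypergeometric}_d(N,n,\boldsymbol{N})$. Then, for all $\boldsymbol{\alpha}=(\alpha_1,\ldots,\alpha_d)\in\mathbb{K}_d$, $$ \begin{aligned} \mathsf{E}\left(\prod_{i=1}^d X_i^{\alpha_i}\right) &= \sum_{k_1=0}^{\alpha_1} \cdots \sum_{k_d=0}^{\alpha_d} \frac{n^{(\|\boldsymbol{k}\|_1)}}{N^{(\|\boldsymbol{k}\|_1)}} \prod_{i=1}^d \genfrac\{\}{0pt}{}{\alpha_i}{k_i} N_i^{(k_i)} \\ &= \sum_{k_1=0}^{\alpha_1} \cdots \sum_{k_d=0}^{\alpha_d} \left\{\frac{\prod_{i=1}^d (N p_i)^{(k_i)}}{N^{(\|\boldsymbol{k}\|_1)} \prod_{i=1}^d p_i^{k_i}}\right\} n^{(\|\boldsymbol{k}\|_1)} \prod_{i=1}^d \genfrac\{\}{0pt}{}{\alpha_i}{k_i} p_i^{k_i}, \end{aligned} $$ where $\boldsymbol{k}=(k_1,\ldots,k_d)$ and $\genfrac\{\}{0pt}{}{\alpha}{k}$ denotes the Stirling number of the second kind.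
   Context: Notation: $\mathbb{N}_0$ is the set of nonnegative integers; $\|\boldsymbol{x}\|_1=\sum_{i=1}^d |x_i|$ for $\boldsymbol{x}\in\mathbb{R}^d$; $\mathcal{S}_d=\{\boldsymbol{x}\in[0,1]^d:\|\boldsymbol{x}\|_1\le 1\}$. For $x\in\mathbb{R}$ and $m\in\mathbb{N}_0$, $x^{(m)}=x(x-1)\cdots(x-m+1)$ is the falling factorial, with $x^{(0)}=1$; ordinary powers are written $x^m$, with $0^0=1$. The Stirling number of the second kind $\genfrac\{\}{0pt}{}{\alpha}{k}$ is the number of ways to partition a set of $\alpha$ objects into $k$ non-empty subsets (so $\genfrac\{\}{0pt}{}{0}{0}=1$). Multivariate hypergeometric distribution: given positive integers $n\le N$ and nonnegative integers $N_1,\ldots,N_{d+1}$ with $N_1+\dots+N_{d+1}=N$, set $$\mathbb{K}_d=\{\boldsymbol{k}\in\mathbb{N}_0^d\cap n\mathcal{S}_d : k_i\in[0,N_i]\text{ for all } i\in\{1,\ldots,d\}\},$$ i.e. the vectors $\boldsymbol{k}\in\mathbb{N}_0^d$ with $k_i\le N_i$ for all $i\in\{1,\ldots,d\}$ and $\|\boldsymbol{k}\|_1\le n$. A random vector $\boldsymbol{X}=(X_1,\ldots,X_d)$ has the $\mathrm{Hypergeometric}_d(N,n,\boldsymbol{N})$ distribution, with $\boldsymbol{N}=(N_1,\ldots,N_d)$ and $N_{d+1}=N-\|\boldsymbol{N}\|_1$, if its probability mass function is $$P_{N,n,\boldsymbol{N}}(\boldsymbol{k})=\binom{N}{n}^{-1}\prod_{i=1}^{d+1}\binom{N_i}{k_i},\quad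 \boldsymbol{k}\in\mathbb{K}_d,$$ where $k_{d+1}=n-\|\boldsymbol{k}\|_1$ (and $\binom{a}{b}=0$ when $b>a$ for nonnegative integers $a,b$). *)

(* Defs.v *)
From mathcomp Require Import all_boot all_order all_algebra.
From mathcomp Require Import all_classical all_reals all_analysis.

Set Implicit Arguments.
Unset Strict Implicit.
Unset Printing Implicit Defensive.

Import Order.TTheory GRing.Theory Num.Theory.

Local Open Scope ring_scope.

(* [n ^_ m] of binomial.v is restricted to a natural base; here the base is
   real, since N * p_i occurs as one. *)
Definition falling (R : realType) (x : R) (m : nat) : R :=
  \prod_(j < m) (x - j%:R).

(* In [finset.partition], set0 is never a block, so blocks are non-empty and
   stirling2 0 0 = 1. *)
Definition stirling2 (a k : nat) : nat :=
  #|[pred P : {set {set 'I_a}} |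
      finset.partition P [set: 'I_a]%SET & #|P| == k]|.

Definition norm1 (d : nat) (k : 'I_d -> nat) : nat := (\sum_(i < d) k i)%N.

Definition hyp_support (d n : nat) (Nv k : 'I_d -> nat) : Prop :=
  (forall i, k i <= Nv i)%N /\ (norm1 k <= n)%N.

(* The last factor is the one of index d+1, with N_{d+1} = N - |Nv|_1 and
   k_{d+1} = n - |k|_1. Both subtractions are on nat: the first is used only
   when |Nv|_1 <= N, the second only on [hyp_support]. *)
Definition hyp_pmf (R : realType) (d N n : nat) (Nv k : 'I_d -> nat) : R :=
  ('C(N, n)%:R)^-1 *
  ((\prod_(i < d) 'C(Nv i, k i)%:R) * 'C(N - norm1 Nv, n - norm1 k)%:R).

(* A random vector is the family of its coordinates. Nothing is required off
   [hyp_support]: the masses on it already add up to 1. *)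
Definition hypergeometric (disp : measure_display) (T : measurableType disp)
    (R : realType) (P : probability T R) (d N n : nat) (Nv : 'I_d -> nat)
    (X : 'I_d -> {RV P >-> R}) : Prop :=
  forall k : 'I_d -> nat, hyp_support n Nv k ->
    P [set w | forall i, X i w = (k i)%:R]%classic = (hyp_pmf R N n Nv k)%:E.

(* Main.v *)
(** Expanding each power by x^a = sum_k S(a,k) x^(k) reduces the statement to
    the joint factorial moments of the hypergeometric law. These follow from
      k^(r) C(M,k) = M^(r) C(M-r,k-r)
    and the multivariate Vandermonde convolution, read off as a coefficient of
    a product of polynomials; the case r = 0 says that the prescribed masses
    add up to 1, so the law of X is carried by the support. *)

Require Import Defs.
From mathcomp Require Import all_boot all_order all_algebra.
From mathcomp Require Import all_classical all_reals all_analysis.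
From mathcomp Require Import measurable_realfun ring.

Set Implicit Arguments.
Unset Strict Implicit.
Unset Printing Implicit Defensive.

Import Order.TTheory GRing.Theory Num.Theory.

Local Open Scope ring_scope.

(** * Set partitions and Stirling numbers *)

Lemma card_partition_le (T : finType) (P : {set {set T}}) (D : {set T}) :
  finset.partition P D -> (#|P| <= #|D|)%N.
Proof.
move=> partP; rewrite (card_partition partP) -sum1_card leq_sum // => B PB.
rewrite card_gt0; apply: contraTneq PB => ->.
by have [_ _] := and3P partP.
Qed.

(** A partition is determined by the relation of lying in a common block, so having kernel [P] can
    be tested on pairs of points. *)
Lemma preim_partition_eqP (T : finType) (rT : eqType) (f : T -> rT)
    (P : {set {set T}}) :
  finset.partition P [set: T]%SET ->
  reflect (forall x y, (f x == f y) = (finset.pblock P x == finset.pblock P y))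
          (preim_partition f [set: T]%SET == P).
Proof.
move=> partP; have [/eqP defT tiP _] := and3P partP.
have covP x : x \in finset.cover P by rewrite defT inE.
apply: (iffP eqP) => [<- x y | eqfP].
  have eqf : {in [set: T]%SET & &, equivalence_rel (fun x y => f x == f y)}.
    by split=> // /eqP->.
  have [/eqP defQ tiQ _] := and3P (preim_partitionP f [set: T]%SET).
  rewrite eq_pblock ?defQ ?inE //.
  by rewrite (pblock_equivalence_partition eqf) ?inE.
rewrite -[RHS](preim_partition_pblock partP).
by apply: eq_in_imset => x _; apply/setP => y; rewrite !inE eqfP.
Qed.

(* A function with kernel P is an injection defined on the blocks of P. *)
Lemma card_preim_partition (T rT : finType) (P : {set {set T}}) :
  finset.partition P [set: T]%SET ->
  #|[pred f : {ffun T -> rT} | preim_partition f [set: T]%SET == P]|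
    = (#|rT| ^_ #|P|)%N.
Proof.
move=> partP; have [/eqP defT tiP P0] := and3P partP.
have blockP x : finset.pblock P x \in P by rewrite pblock_mem // defT inE.
pose D : finType := {B | B \in P}.
pose b x : D := Sub (finset.pblock P x) (blockP x).
have b_surj (B : D) : exists x, b x == B.
  have /set0Pn[x Bx] : val B != finset.set0 := memPn P0 _ (valP B).
  by exists x; rewrite -val_eqE /= (def_pblock tiP (valP B) Bx).
have bE x y : (b x == b y) = (finset.pblock P x == finset.pblock P y) by rewrite -val_eqE.
(* [b] is the quotient map onto the blocks and [r] a section of it; composing with [r] undoes [h]
   below. *)
pose r B := xchoose (b_surj B).
have rK B : b (r B) = B by apply/eqP; exact: (xchooseP (b_surj B)).
have <- : #|D| = #|P| by rewrite card_sig.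
rewrite -card_inj_ffuns.
pose h (g : {ffun D -> rT}) := [ffun x => g (b x)].
have h_inj : injective h.
  move=> g1 g2 /ffunP eqg; apply/ffunP => B.
  by have := eqg (r B); rewrite !ffunE rK.
rewrite -(card_imset _ h_inj); apply: eq_card => f; rewrite inE.
apply/(preim_partition_eqP _ partP)/imsetP => [eqf | [g]].
  exists [ffun B => f (r B)]; last first.
    by apply/ffunP => x; rewrite !ffunE; apply/eqP; rewrite eqf -bE rK.
  rewrite inE; apply/injectiveP => B1 B2; rewrite !ffunE => /eqP.
  by rewrite eqf -bE !rK => /eqP.
rewrite inE => /injectiveP g_inj -> x y.
by rewrite !ffunE (inj_eq g_inj) bE.
Qed.

(** Counts the functions from ['I_a] to ['I_m] by their kernel, then groups the kernels by number of
    blocks. *)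
Lemma expn_stirling2 (m a : nat) :
  (m ^ a = \sum_(k < a.+1) stirling2 a k * m ^_ k)%N.
Proof.
have <- : #|{ffun 'I_a -> 'I_m}| = (m ^ a)%N by rewrite card_ffun !card_ord.
rewrite -sum1_card (partition_big
  (fun f : {ffun 'I_a -> 'I_m} => preim_partition f [set: 'I_a]%SET)
  (fun P => finset.partition P [set: 'I_a]%SET)) /=; last first.
  by move=> f _; exact: preim_partitionP.
under eq_bigr => P partP.
  rewrite sum1_card (card_preim_partition _ partP) card_ord.
  over.
rewrite (partition_big (fun P : {set {set 'I_a}} => inord #|P| : 'I_a.+1) xpredT) //=.
apply: eq_bigr => k _; rewrite /stirling2 -sum_nat_const.
(* A partition of [a] points has at most [a] blocks, so [inord] never falls back on its default
   value. *)
have szP P : finset.partition P [set: 'I_a]%SET ->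
    (inord #|P| == k) = (#|P| == k :> nat).
  move=> partP; rewrite -val_eqE /= inordK // ltnS.
  by rewrite (leq_trans (card_partition_le partP)) // cardsT card_ord.
apply: eq_big => [P | P /andP[partP]].
  by rewrite !inE; apply: andb_id2l => /szP.
by rewrite szP // => /eqP->.
Qed.

(** * Generating polynomials and the Vandermonde convolution *)

Lemma big_dffun_distr (A : comNzRingType) (I : finType) (T_ : I -> finType)
    (F : forall i, T_ i -> A) :
  \prod_i \sum_(j : T_ i) F i j
    = \sum_(g : {dffun forall i, T_ i}) \prod_i F i (g i).
Proof.
rewrite (reindex (@dffun_of_fprod _ T_)); last exact/onW_bij/dffun_of_fprod_bij.
transitivity (\sum_(t : fprod T_) \prod_(i in I) [ffun j => F i j] (t i)).
  rewrite big_fprod.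
  (* The type of the summation index varies with [i]; summing over pairs with tag [i] gives all
     factors one index type, as [bigA_distr_big_dep] requires. *)
  under eq_bigr => i _ do rewrite (big_tag (fun i j => F i j)).
  rewrite bigA_distr_big_dep; apply: eq_bigr => g /familyP gT.
  apply: eq_bigr => i _; have := gT i; rewrite inE => /eqP.
  by case: (g i) => j t /= e; subst j; rewrite !untagE ?ffunE.
by apply: eq_bigr => t _; apply: eq_bigr => i _; rewrite !ffunE.
Qed.

(** Iterates the absorption identity i C(m, i) = m C(m-1, i-1), by induction on [r]. *)
Lemma ffact_mul_bin (m r i : nat) :
  (r <= i -> i ^_ r * 'C(m, i) = m ^_ r * 'C(m - r, i - r))%N.
Proof.
elim: r m i => [|r IHr] m [|i] //; rewrite ?ffactn0 ?subn0 // => le_ri.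
rewrite !ffactnS mulnAC -mul_bin_diag -!mulnA [('C(_, _) * _)%N]mulnC /=.
by rewrite IHr // subSS -subn1 -subnDA add1n.
Qed.

Lemma coef_Xadd1n (A : comNzRingType) (m i : nat) :
  (('X + 1 : {poly A}) ^+ m)`_i = 'C(m, i)%:R.
Proof.
rewrite exprD1n coef_sum.
under eq_bigr do rewrite coefMn coefXn.
have [lt_im|le_mi] := ltnP i m.+1.
  rewrite (bigD1 (Ordinal lt_im)) //= eqxx big1 ?addr0 // => j.
  by rewrite -val_eqE /= eq_sym => /negPf->; rewrite mul0rn.
rewrite bin_small // big1 // => j _.
by rewrite gtn_eqF ?mul0rn // (leq_trans (ltn_ord j)).
Qed.

(** Both sides are X^r times the r-th derivative of (X + 1)^m; [ffact_mul_bin] matches the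
    coefficients. *)
Lemma sum_ffact_bin_poly (A : comNzRingType) (m r : nat) : (r <= m)%N ->
  \sum_(j < m.+1) (j ^_ r * 'C(m, j))%:R *: 'X^j
    = (m ^_ r)%:R *: ('X^r * ('X + 1) ^+ (m - r)) :> {poly A}.
Proof.
move=> le_rm; rewrite -(poly_def m.+1 (fun j => (j ^_ r * 'C(m, j))%:R)).
apply/polyP => i; rewrite coef_poly coefZ coefXnM coef_Xadd1n.
have [lt_ir|le_ri] := ltnP i r.
  by rewrite ffact_small ?mul0n ?mulr0 ?if_same.
rewrite -natrM ffact_mul_bin //; case: ltnP => // lt_mi.
(* Past degree [m] the left coefficient is 0; on the right i - r exceeds m - r, because r <= m <
   i. *)
rewrite [X in (_ * X)%N]bin_small ?muln0 // ltn_sub2r //.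
by rewrite (leq_ltn_trans le_rm).
Qed.

Lemma norm1B (d : nat) (k r : 'I_d -> nat) : (forall i, r i <= k i)%N ->
  norm1 (fun i => k i - r i)%N = (norm1 k - norm1 r)%N.
Proof. by move=> le_rk; rewrite /norm1 sumnB. Qed.

Lemma prod_scaleXn (A : comNzRingType) (d : nat) (c : 'I_d -> A)
    (k : 'I_d -> nat) (q : 'I_d -> {poly A}) :
  \prod_i (c i *: ('X^(k i) * q i))
    = (\prod_i c i) *: ('X^(norm1 k) * \prod_i q i).
Proof. by rewrite -prodrXr -big_split -scaler_prod. Qed.

(* Compare the coefficients of X^n in
   prod_i (sum_j j^(r_i) C(N_i, j) X^j) (1 + X)^M
     = prod_i (N_i^(r_i) X^(r_i) (1 + X)^(N_i - r_i)) (1 + X)^M. *)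
Lemma sum_ffact_bin (A : comNzRingType) (d n M : nat) (Nv r : 'I_d -> nat) :
  hyp_support n Nv r ->
  \sum_(k : {dffun forall i : 'I_d, 'I_(Nv i).+1}
        | (norm1 (fun i => k i) <= n)%N)
     (\prod_(i < d) (k i ^_ r i * 'C(Nv i, k i))%:R)
       * 'C(M, n - norm1 (fun i => k i))%:R
    = (\prod_(i < d) (Nv i ^_ r i)%:R)
       * 'C(norm1 Nv + M - norm1 r, n - norm1 r)%:R :> A.
Proof.
move=> [le_rN le_rn].
pose p i : {poly A} := \sum_(j < (Nv i).+1) (j ^_ r i * 'C(Nv i, j))%:R *: 'X^j.
transitivity ((\prod_i p i * ('X + 1) ^+ M)`_n).
  rewrite big_dffun_distr mulr_suml coef_sum [LHS]big_mkcond /=.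
  apply: eq_bigr => k _.
  (* Unit cofactors bring the monomials into the shape of [prod_scaleXn]. *)
  symmetry; under eq_bigr do rewrite -['X^_]mulr1.
  rewrite prod_scaleXn big1_eq mulr1 -scalerAl coefZ coefXnM coef_Xadd1n.
  by case: leqP; rewrite ?mulr0.
under eq_bigr do rewrite /p sum_ffact_bin_poly //.
rewrite prod_scaleXn prodrXr -/(norm1 _) norm1B // -scalerAl -mulrA -exprD.
rewrite coefZ coefXnM coef_Xadd1n ltnNge le_rn addnBAC //.
by rewrite /norm1 leq_sum.
Qed.

(** * Factorial moments and expectations over atoms *)

Lemma falling_nat (R : realType) (m r : nat) :
  falling m%:R r = (m ^_ r)%:R :> R.
Proof.
elim: r => [|r IHr]; rewrite /falling ?big_ord0 // big_ord_recr /= -/(falling _ _).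
rewrite IHr ffactnSr natrM; have [lt_mr|le_rm] := ltnP m r.
  by rewrite ffact_small ?mul0r.
by rewrite natrB.
Qed.

(** The case [i = n] of [ffact_mul_bin], divided by C(N, n) and N^(s), which are nonzero since s <=
    n <= N. *)
Lemma bin_ratio (R : realType) (N n s : nat) : (n <= N)%N -> (s <= n)%N ->
  'C(N, n)%:R^-1 * 'C(N - s, n - s)%:R = falling n%:R s / falling N%:R s :> R.
Proof.
move=> le_nN le_sn; rewrite !falling_nat.
have C_neq0 : 'C(N, n)%:R != 0 :> R by rewrite pnatr_eq0 -lt0n bin_gt0.
have F_neq0 : (N ^_ s)%:R != 0 :> R.
  by rewrite pnatr_eq0 -lt0n ffact_gt0 (leq_trans le_sn).
apply: (mulfI C_neq0); rewrite mulrA mulfV // mul1r.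
apply: (mulfI F_neq0).
rewrite -natrM -ffact_mul_bin // mulrCA [X in _ * X]mulrC divfK //.
by rewrite mulrC natrM mulrC.
Qed.

(** The disjoint events [A i] with [i] in [Q] have total mass 1, so the complement of their union is
    null and contributes nothing to the integral; on each event [f] is constant. *)
Lemma expectation_atoms (disp : measure_display) (T : measurableType disp)
    (R : realType) (P : probability T R) (I : finType) (Q : {pred I})
    (A : I -> set T) (v : I -> R) (f : T -> R) :
  measurable_fun [set: T]%classic f ->
  (forall i, measurable (A i)) -> trivIset [set` Q] A ->
  (\sum_(i in Q) P (A i) = 1)%E ->
  (forall i w, i \in Q -> A i w -> f w = v i) ->
  'E_P[f]%E = (\sum_(i in Q) (v i)%:E * P (A i))%E.
Proof.
move=> mf mA tA PA1 fv; rewrite unlock.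
have mfE (D : set T) : measurable_fun D (EFin \o f).
  by apply/measurable_EFinP; exact: measurable_funTS.
have tA' : trivIset [set` enum Q] A.
  by apply: sub_trivIset tA => i /=; rewrite mem_enum.
pose U := \big[setU/set0]_(i <- enum Q) A i.
have mU : measurable U by exact: bigsetU_measurable.
have PU : P U = 1%E.
  (* As an integral of 1, the mass of [U] splits over the atoms in the same way as the integral of
     [f] below. *)
  transitivity (\int[P]_(w in U) (cst 1%R w)%:E)%E.
    by rewrite (integral_cst P mU 1%E) mul1e.
  rewrite -[RHS]PA1 -big_enum /U integral_bigsetU_EFin ?enum_uniq //; last first.
    by apply/measurable_EFinP; exact: measurable_cst.
  by apply: eq_bigr => i _; rewrite (integral_cst P (mA i) 1%E) mul1e.
have PCU : P (~` U)%classic = 0%E by rewrite probability_setC // PU subee.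
rewrite -(setUv U) integral_setU //; last 2 first.
- exact: measurableC.
- by apply/disj_setPS; rewrite setICr.
rewrite [X in (_ + X)%E](ae_eq_integral (cst 0%E)) //; last 2 first.
- exact: measurableC.
- by apply: ae_eq0 => //; exact: measurableC.
rewrite integral0 adde0 /U integral_bigsetU_EFin ?enum_uniq //.
rewrite big_enum; apply: eq_bigr => i iQ /=.
rewrite -integral_cst //; apply: eq_integral => w; rewrite inE => Aw.
by rewrite (fv i).
Qed.

(** This is [sum_ffact_bin] with M = N - |Nv|_1, the size of the last class; [bin_ratio] accounts
    for the normalising factor 1 / C(N, n). *)
Lemma hyp_factorial_moment (R : realType) (d n N : nat) (Nv r : 'I_d -> nat) :
  (norm1 Nv <= N)%N -> (n <= N)%N -> hyp_support n Nv r ->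
  \sum_(k : {dffun forall i : 'I_d, 'I_(Nv i).+1}
        | (norm1 (fun i => k i) <= n)%N)
     (\prod_(i < d) (k i ^_ r i)%:R) * hyp_pmf R N n Nv (fun i => k i)
    = falling n%:R (norm1 r) / falling N%:R (norm1 r)
      * \prod_(i < d) falling (Nv i)%:R (r i).
Proof.
move=> le_NvN le_nN r_supp; have [_ le_rn] := r_supp.
rewrite -(bin_ratio R le_nN le_rn) mulrAC -mulrA.
under [in RHS]eq_bigr do rewrite falling_nat.
rewrite -[in 'C(N - _, _)](subnKC le_NvN) -sum_ffact_bin // mulr_sumr.
apply: eq_bigr => k _; rewrite /hyp_pmf mulrCA; congr (_ * _).
rewrite mulrA -big_split /=; congr (_ * _).
by apply: eq_bigr => i _; rewrite natrM.
Qed.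

(** * Mixed moments of the hypergeometric vector *)

Theorem theorem1 (R : realType) (disp : measure_display)
    (T : measurableType disp) (P : probability T R)
    (d n N : nat) (Nv : 'I_d -> nat) (Nlast : nat) (p : 'I_d -> R)
    (X : 'I_d -> {RV P >-> R}) (alpha : 'I_d -> nat)
    (hd : (0 < d)%N) (hn : (0 < n)%N) (hN : (0 < N)%N) (hnN : (n <= N)%N)
    (hsum : (\sum_(i < d) Nv i + Nlast)%N = N)
    (hp : forall i, p i = (Nv i)%:R / N%:R)
    (hX : hypergeometric N n Nv X)
    (halpha : hyp_support n Nv alpha) :
  'E_P[fun w => (\prod_(i < d) X i w ^+ alpha i)%R]%E
    = (\sum_(k : {dffun forall i : 'I_d, 'I_(alpha i).+1})
         falling n%:R (norm1 (fun i => k i))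
         / falling N%:R (norm1 (fun i => k i))
         * \prod_(i < d) ((stirling2 (alpha i) (k i))%:R
                          * falling (Nv i)%:R (k i)))%:E
  /\
  \sum_(k : {dffun forall i : 'I_d, 'I_(alpha i).+1})
      falling n%:R (norm1 (fun i => k i)) / falling N%:R (norm1 (fun i => k i))
      * \prod_(i < d) ((stirling2 (alpha i) (k i))%:R
                       * falling (Nv i)%:R (k i))
    = \sum_(k : {dffun forall i : 'I_d, 'I_(alpha i).+1})
        ((\prod_(i < d) falling (N%:R * p i) (k i))
           / (falling N%:R (norm1 (fun i => k i)) * \prod_(i < d) p i ^+ k i))
        * falling n%:R (norm1 (fun i => k i))
        * \prod_(i < d) ((stirling2 (alpha i) (k i))%:R * p i ^+ k i)
    :> R.
Proof.
have [le_aN le_an] := halpha.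
have le_NvN : (norm1 Nv <= N)%N by rewrite -hsum leq_addr.
have N_neq0 : N%:R != 0 :> R by rewrite pnatr_eq0 -lt0n.
split; last first.
  apply: eq_bigr => k _; rewrite !big_split /=.
  have -> : \prod_(i < d) falling (N%:R * p i) (k i)
      = \prod_(i < d) falling ((Nv i)%:R : R) (k i).
    by apply: eq_bigr => i _; rewrite hp mulrC divfK.
  have pk_neq0 : \prod_(i < d) p i ^+ k i != 0.
    (* If p_i = 0 then N_i = 0, so k_i <= alpha_i <= N_i vanishes as well. *)
    apply/prodf_neq0 => i _; rewrite hp expf_eq0 mulf_eq0 invr_eq0.
    rewrite (negPf N_neq0) orbF pnatr_eq0; apply/nandP.
    have [Ni0|] := eqVneq (Nv i) 0%N; last by right.
    left; rewrite -leqNgt -Ni0.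
    by apply: leq_trans (le_aN i); rewrite -ltnS.
  (* Naming the inverse hides the falling factorial of [N] from [field], which is left with
     [pk_neq0] as side condition. *)
  rewrite invfM; set Finv := (falling N%:R _)^-1; set q := \prod_(i < d) p i ^+ _.
  by field.
pose A (k : {dffun forall i : 'I_d, 'I_(Nv i).+1}) : set T :=
  [set w | forall i, X i w = (k i)%:R]%classic.
(* The box k_i <= N_i is a finite type, and [Q] cuts the support out of it. *)
pose Q := [pred k : {dffun forall i : 'I_d, 'I_(Nv i).+1}
             | (norm1 (fun i => k i) <= n)%N].
have PA k : k \in Q -> P (A k) = (hyp_pmf R N n Nv (fun i => k i))%:E.
  by move=> kQ; apply: hX; split => // i; rewrite -ltnS.
have mA k : measurable (A k).
  have -> : A k = (\bigcap_(i in [set: 'I_d]) (X i @^-1` [set (k i)%:R]))%classic.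
    by apply/seteqP; split => w /= Aw i => [_|]; apply: Aw.
  by apply: fin_bigcap_measurable => // i _; rewrite -[X in measurable X]setTI;
     apply: measurable_funP.
have tA : trivIset [set` Q] A.
  move=> k l _ _ [w [kw lw]]; apply/ffunP => i; apply/val_inj/eqP.
  by rewrite /= -(eqr_nat R) -kw lw.
have fmoment r : hyp_support n Nv r ->
    \sum_(k in Q) (\prod_(i < d) (k i ^_ r i)%:R)
                   * hyp_pmf R N n Nv (fun i => k i)
    = falling n%:R (norm1 r) / falling N%:R (norm1 r)
      * \prod_(i < d) falling (Nv i)%:R (r i).
  exact: hyp_factorial_moment.
have sumPA : (\sum_(k in Q) P (A k) = 1)%E.
  rewrite (eq_bigr _ PA) sumEFin; congr _%:E.
  have norm0 : norm1 (fun _ : 'I_d => 0%N) = 0%N by rewrite /norm1 big1.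
  have falling0 (x : R) : falling x 0 = 1 by rewrite /falling big_ord0.
  have supp0 : hyp_support n Nv (fun=> 0%N) by split; rewrite ?norm0.
  have := fmoment _ supp0; rewrite norm0 2!falling0 divr1 mul1r.
  rewrite [X in _ = X -> _]big1 // => <-.
  by apply: eq_bigr => k _; rewrite big1 ?mul1r.
rewrite (expectation_atoms (A := A) (Q := Q)
  (v := fun k => \prod_(i < d) (k i)%:R ^+ alpha i)) //; last 2 first.
- by apply: measurable_prod => i _; apply: measurable_funX.
- by move=> k w _ Akw; apply: eq_bigr => i _; rewrite Akw.
under eq_bigr => k kQ do rewrite PA // -EFinM.
rewrite sumEFin; congr _%:E.
(* The Stirling expansion of each power gives a sum over multi-indices r <= alpha; once the two sums
   are exchanged, each [r] leaves one factorial moment. *)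
transitivity (\sum_(k in Q) \sum_(r : {dffun forall i : 'I_d, 'I_(alpha i).+1})
    (\prod_(i < d) (stirling2 (alpha i) (r i))%:R)
    * ((\prod_(i < d) (k i ^_ r i)%:R) * hyp_pmf R N n Nv (fun i => k i))).
  apply: eq_bigr => k _.
  under eq_bigr do rewrite -natrX expn_stirling2 natr_sum.
  rewrite (big_dffun_distr (fun i (j : 'I_(alpha i).+1) =>
    (stirling2 (alpha i) j * (k i) ^_ j)%:R)) mulr_suml.
  apply: eq_bigr => r _; rewrite mulrA -big_split /=; congr (_ * _).
  by apply: eq_bigr => i _; rewrite natrM.
rewrite exchange_big /=; apply: eq_bigr => r _.
have le_ra i : (r i <= alpha i)%N by rewrite -ltnS.
(* The support is closed under decreasing coordinates, so [r] inherits membership from [alpha]. *)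
rewrite -mulr_sumr fmoment; last first.
  split=> [i|]; first exact: leq_trans (le_aN i).
  by apply: leq_trans le_an; exact: leq_sum.
by rewrite big_split mulrCA.
Qed.
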